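(* Let $G$ and $H$ be graphs with $G$ connected, $V(G)=\{v_1,\dots,v_n\}$, and let $X,Y$ be vertex covers of $\widehat{G}$. The set $$S=\Big(\bigcup_{v_i\in X} V(H_i)\Big)\cup Y$$ is a distance-equalizer set of $G\odot H$ if and only if $(X,Y)$ is a forward-equalized pair of $G$.
   Context: All graphs are finite, simple and undirected. For a connected graph $\Gamma$, a set $S\subseteq V(\Gamma)$ is a distance-equalizer set if for every two distinct $u,v\in V(\Gamma)\setminus S$ there is $w\in S$ with $d_\Gamma(w,u)=d_\Gamma(w,v)$. The corona product $G\odot H$ is obtained from $G$ and $n$ pairwise disjoint copies $H_1,\dots,H_n$ of $H$ by joining $v_i$ to every vertex of $H_i$. The empty bisector graph $\widehat{G}$ has vertex set $V(G)$, with distinct $u,v$ adjacent iff there is no $w\in V(G)$ with $d_G(w,u)=d_G(w,v)$. A pair $(X,Y)$ of subsets of $V(G)$ with $X\cup Y=V(G)$ is a forward-equalized pair of $G$ if for every $(u,v)\in (X\setminus Y)\times(Y\setminus X)$ there exists $w\in V(G)$ with $d_G(w,u)=d_G(w,v)+1$ (in particular being a forward-equalized pair requires $X\cup Y=V(G)$). *)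

(* Defs.v *)
From mathcomp Require Import all_boot.

Set Implicit Arguments.
Unset Strict Implicit.
Unset Printing Implicit Defensive.

Record sgraph := SGraph {
  vertex :> finType;
  adj : rel vertex;
  adj_sym : symmetric adj;
  adj_irrefl : irreflexive adj }.

Definition connected (G : sgraph) : Prop := forall x y : G, connect (@adj G) x y.

(* Walks of length k; a tuple lists the vertices after the initial one. *)
Definition walk (G : sgraph) (k : nat) (x y : G) : bool :=
  [exists p : k.-tuple G, path (@adj G) x p && (last x p == y)].

(* Least length of a walk from x to y. Searching lengths below #|G| suffices
   by shortening; the junk value for unreachable pairs is #|G|. *)
Definition dist (G : sgraph) (x y : G) : nat :=
  find (fun k => walk k x y) (iota 0 #|G|).

Lemma dist_min (G : sgraph) (k : nat) (x y : G) : walk k x y -> dist x y <= k.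
Proof.
move=> w; have [lt_k|le_k] := ltnP k #|G|; last first.
  by apply: leq_trans le_k; rewrite -[leqRHS](size_iota 0); apply: find_size.
rewrite leqNgt; apply/negP => /(before_find 0).
by rewrite nth_iota // add0n w.
Qed.

Lemma dist_walk (G : sgraph) (x y : G) :
  connect (@adj G) x y -> walk (dist x y) x y.
Proof.
case/connectP => p pp ->; case: (shortenP pp) => q pq uq _.
have ltq : size q < #|G| by have := max_card (mem (x :: q)); rewrite (card_uniqP uq).
have wq : walk (size q) x (last x q).
  by apply/existsP; exists (in_tuple q); rewrite /= pq eqxx.
have hs : has (fun k => walk k x (last x q)) (iota 0 #|G|).
  by apply/hasP; exists (size q); rewrite // mem_iota.
have := nth_find 0 hs; rewrite nth_iota ?add0n //.
by move: hs; rewrite has_find size_iota.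
Qed.

Definition vertex_cover (G : sgraph) (C : {set G}) : Prop :=
  forall u v : G, adj u v -> (u \in C) \/ (v \in C).

Definition distance_equalizer (G : sgraph) (S : {set G}) : Prop :=
  forall u v : G, u \notin S -> v \notin S -> u != v ->
  exists2 w : G, w \in S & dist w u = dist w v.

Definition empty_bisector_adj (G : sgraph) : rel G :=
  fun u v => (u != v) && ~~ [exists w : G, dist w u == dist w v].

Lemma empty_bisector_sym (G : sgraph) : symmetric (@empty_bisector_adj G).
Proof.
move=> u v; rewrite /empty_bisector_adj eq_sym.
by under eq_existsb do rewrite eq_sym.
Qed.

Lemma empty_bisector_irrefl (G : sgraph) : irreflexive (@empty_bisector_adj G).
Proof. by move=> u; rewrite /empty_bisector_adj eqxx. Qed.

Definition empty_bisector (G : sgraph) : sgraph :=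
  SGraph (@empty_bisector_sym G) (@empty_bisector_irrefl G).

Definition forward_equalized (G : sgraph) (X Y : {set G}) : Prop :=
  X :|: Y = [set: G] /\
  forall u v : G, u \in X :\: Y -> v \in Y :\: X ->
  exists w : G, dist w u = dist w v + 1.

(* inl v is the vertex v of G; inr (v, h) is the vertex h of the copy of H
   attached to v. *)
Definition corona_adj (G H : sgraph) : rel (G + G * H)%type := fun x y =>
  match x, y with
  | inl u, inl v => adj u v
  | inl u, inr (v, _) => u == v
  | inr (u, _), inl v => u == v
  | inr (u, h), inr (v, k) => (u == v) && adj h k
  end.

Lemma corona_sym (G H : sgraph) : symmetric (@corona_adj G H).
Proof.
by case=> [u|[u h]] [v|[v k]] //=; rewrite ?(adj_sym u) ?(adj_sym h) // eq_sym.
Qed.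

Lemma corona_irrefl (G H : sgraph) : irreflexive (@corona_adj G H).
Proof. by case=> [u|[u h]] /=; rewrite !adj_irrefl ?andbF. Qed.

Definition corona (G H : sgraph) : sgraph :=
  SGraph (@corona_sym G H) (@corona_irrefl G H).

Definition corona_base (G H : sgraph) (v : G) : corona G H := inl v.

Definition corona_copy (G H : sgraph) (v : G) : {set corona G H} :=
  [set (inr (v, h) : corona G H) | h : H].

(* Distances in the corona are thus never junk values when G is connected. *)
Lemma corona_connected (G H : sgraph) : connected G -> connected (corona G H).
Proof.
move=> cG.
have csym : connect_sym (@adj (corona G H)).
  exact/sym_connect_sym/(@adj_sym (corona G H)).
have cb u v : connect (@adj (corona G H)) (inl u) (inl v).
  case/connectP: (cG u v) => p; elim: p u => [|w p IH] u /= => [_ ->|] //.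
  case/andP=> uw pw lw; apply: connect_trans (IH w pw lw).
  exact: (@connect1 _ _ (inl u : corona G H) (inl w)).
pose pr (x : corona G H) : G := match x with inl v => v | inr (v, _) => v end.
have cx x : connect (@adj (corona G H)) x (inl (pr x)).
  by case: x => [v|[v h]]; [exact: connect0 | apply: connect1; rewrite /= eqxx].
move=> x y; apply: connect_trans (cx x) _; apply: connect_trans (cb _ _) _.
by rewrite csym.
Qed.

(* Main.v *)
Require Import Defs.
From mathcomp Require Import all_boot.
From mathcomp Require Import zify.

Set Implicit Arguments.
Unset Strict Implicit.
Unset Printing Implicit Defensive.

(** Distances in the corona are distances in [G] plus one for each endpoint
    lying in a copy of [H], except between two vertices of the same copy.
    Hence a vertex of [G] or of a copy attached to a third vertex equalizes two
    vertices of the same kind exactly when its base does so in [G], and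
    equalizes [inl u] and [inr (v, k)] exactly when its base [w] satisfies
    [dist w u = dist w v + 1].  The covers [X] and [Y] of the empty bisector
    graph handle the pairs of the same kind, forward equalization the mixed
    pairs, and [X :|: Y = setT] puts a suitable vertex above [w] in the set. *)

Lemma walkP (G : sgraph) (k : nat) (x y : G) :
  reflect (exists p : seq G, [/\ path (@adj G) x p, size p = k & last x p = y])
          (walk k x y).
Proof.
apply: (iffP existsP) => [[p /andP[pp /eqP lp]]|[p [pp sp lp]]].
  by exists p; rewrite size_tuple.
by exists (Tuple (introT eqP sp)); rewrite /= pp lp eqxx.
Qed.

Lemma dist_refl (G : sgraph) (x : G) : dist x x = 0.
Proof.
by apply/eqP; rewrite -leqn0; apply/dist_min/walkP; exists [::].
Qed.

Section ConnectedGraph.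
Variables (G : sgraph) (hG : connected G).

Lemma dist_stepl (x y z : G) : adj x y -> dist x z <= (dist y z).+1.
Proof.
move=> xy; have /walkP[p [pp sp lp]] := dist_walk (hG y z).
by apply/dist_min/walkP; exists (y :: p); rewrite /= xy pp sp lp.
Qed.

Lemma dist_stepr (x y z : G) : adj y z -> dist x z <= (dist x y).+1.
Proof.
move=> yz; have /walkP[p [pp sp lp]] := dist_walk (hG x y).
by apply/dist_min/walkP; exists (rcons p z);
  rewrite rcons_path last_rcons size_rcons pp sp lp.
Qed.

(** Along a shortest walk from [x] to [y], [f] drops by at most one per edge. When [f y = 0] this
    bounds [dist x y] from below, with no case analysis of walks in the corona. *)
Lemma lipschitz_le_dist (f : G -> nat) :
  (forall a b, adj a b -> f a <= (f b).+1) ->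
  forall x y, f x <= dist x y + f y.
Proof.
move=> hf x y; have /walkP[p [pp <- <-]] := dist_walk (hG x y).
elim: p x pp => [|z p IH] x //= /andP[xz /IH]; have := hf _ _ xz; lia.
Qed.

End ConnectedGraph.

Section CoronaDistance.
Variables (G H : sgraph) (hG : connected G).
Let hGH := @corona_connected G H hG.

Lemma corona_dist_base_le (u v : G) :
  dist (inl u : corona G H) (inl v) <= dist u v.
Proof.
have /walkP[p [pp sp lp]] := dist_walk (hG u v).
apply/dist_min/walkP; exists (map (@corona_base G H) p).
by rewrite size_map (last_map (@corona_base G H)) lp path_map.
Qed.

(** The intended distance to [inl v], serving as the potential for the lower bounds. *)
Let to_base (v : G) (x : corona G H) : nat :=
  match x with inl a => dist a v | inr (a, _) => (dist a v).+1 end.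

Let to_base_lipschitz (v : G) (a b : corona G H) :
  adj a b -> to_base v a <= (to_base v b).+1.
Proof.
case: a b => [a|[a h]] [b|[b k]] /=.
- exact: dist_stepl.
- by move=> /eqP->; lia.
- by move=> /eqP->; lia.
- by case/andP=> /eqP->; lia.
Qed.

Lemma corona_dist_base (u v : G) :
  dist (inl u : corona G H) (inl v) = dist u v.
Proof.
have := lipschitz_le_dist hGH (to_base_lipschitz v) (inl u) (inl v).
have := corona_dist_base_le u v; rewrite /= dist_refl; lia.
Qed.

Lemma corona_dist_copy_base (u v : G) (h : H) :
  dist (inr (u, h) : corona G H) (inl v) = (dist u v).+1.
Proof.
have := lipschitz_le_dist hGH (to_base_lipschitz v) (inr (u, h)) (inl v).
have := @dist_stepl _ hGH (inr (u, h)) (inl u) (inl v) (eqxx u).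
by rewrite corona_dist_base /= dist_refl; lia.
Qed.

(* Zero on the whole copy attached to [v], so only a lower bound there. *)
Let to_copy (v : G) (x : corona G H) : nat :=
  match x with
  | inl a => (dist a v).+1
  | inr (a, _) => if a == v then 0 else (dist a v).+2
  end.

Let to_copy_lipschitz (v : G) (a b : corona G H) :
  adj a b -> to_copy v a <= (to_copy v b).+1.
Proof.
case: a b => [a|[a h]] [b|[b k]] /=.
- exact: dist_stepl.
(* If the edge is based at [v], the bound is tight: the two values are [(dist v v).+1 = 1] and 0. *)
- by move=> /eqP->; case: eqP => [->|_]; rewrite ?dist_refl; lia.
- by move=> /eqP->; case: eqP; lia.
- by case/andP=> /eqP->; lia.
Qed.

Lemma corona_dist_base_copy (u v : G) (k : H) :
  dist (inl u : corona G H) (inr (v, k)) = (dist u v).+1.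
Proof.
have := lipschitz_le_dist hGH (to_copy_lipschitz v) (inl u) (inr (v, k)).
have := @dist_stepr _ hGH (inl u) (inl v) (inr (v, k)) (eqxx v).
by rewrite corona_dist_base /= eqxx; lia.
Qed.

(** Passing from one copy to another goes through both attachment vertices, at a cost of one each;
    within a single copy the distance depends on [H]. *)
Lemma corona_dist_copy (u v : G) (h k : H) : u != v ->
  dist (inr (u, h) : corona G H) (inr (v, k)) = (dist u v).+2.
Proof.
move=> /negPf uv.
have := lipschitz_le_dist hGH (to_copy_lipschitz v) (inr (u, h)) (inr (v, k)).
have := @dist_stepl _ hGH (inr (u, h)) (inl u) (inr (v, k)) (eqxx u).
by rewrite corona_dist_base_copy /= eqxx uv; lia.
Qed.

End CoronaDistance.

Section CoronaSet.
Variables (G H : sgraph) (X Y : {set G}).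
Let S := (\bigcup_(v in X) corona_copy H v) :|: (@corona_base G H) @: Y.

Lemma mem_corona_base (v : G) : ((inl v : corona G H) \in S) = (v \in Y).
Proof.
rewrite inE mem_imset => [|a b [] //].
by case: bigcupP => // -[a _ /imsetP[]].
Qed.

Lemma mem_corona_copy (v : G) (h : H) :
  ((inr (v, h) : corona G H) \in S) = (v \in X).
Proof.
rewrite inE; apply/orP/idP => [[/bigcupP[a aX /imsetP[k _ [->]]]|/imsetP[]]|vX] //.
by left; apply/bigcupP; exists v => //; apply: imset_f.
Qed.

End CoronaSet.

(** Two distinct vertices missed by a cover cannot be adjacent in the empty bisector graph. The case
    [u = v] is included because two vertices of one copy share their base. *)
Lemma vertex_cover_bisector (G : sgraph) (C : {set G}) (u v : G) :
  vertex_cover (C : {set empty_bisector G}) -> u \notin C -> v \notin C ->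
  exists w : G, dist w u = dist w v.
Proof.
move=> hC /negPf uC /negPf vC; have [<-|uv] := eqVneq u v; first by exists u.
case: (boolP [exists w : G, dist w u == dist w v]) => [/existsP[w /eqP]|nw].
  by exists w.
have := hC u v; rewrite uC vC /= /empty_bisector_adj uv nw.
by case/(_ isT).
Qed.

Theorem theorem13 (G H : sgraph) (hG : connected G) (hH : 0 < #|H|)
    (X Y : {set G})
    (hX : vertex_cover (X : {set empty_bisector G}))
    (hY : vertex_cover (Y : {set empty_bisector G})) :
  distance_equalizer
    ((\bigcup_(v in X) corona_copy H v) :|: (@corona_base G H) @: Y)
  <-> forward_equalized X Y.
Proof.
have /card_gt0P[h0 _] := hH.
set S := _ :|: _.
have SE := (mem_corona_base H X Y, @mem_corona_copy G H X Y).
have mixed u v k : u \notin Y -> v \notin X ->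
    (exists2 w, w \in S & dist w (inl u) = dist w (inr (v, k))) ->
    exists w : G, dist w u = dist w v + 1.
  move=> uY vX [[w|[w h]]]; rewrite SE => wS.
    by rewrite corona_dist_base // corona_dist_base_copy // => e; exists w; lia.
  (* A copy vertex in [S] has its base in [X], so it lies outside the copy at [v]. *)
  have wv : w != v by apply: contraNneq vX => <-.
  by rewrite corona_dist_copy_base // corona_dist_copy // => e; exists w; lia.
split=> [hS|[hXY hF]].
  split=> [|u v]; last first.
    rewrite !inE => /andP[uY uX] /andP[vX vY].
    by apply: (mixed u v h0) => //; apply: hS; rewrite ?SE.
  (* If [v] were in neither set, [inl v] and [inr (v, h0)] would both miss [S], and equalizing them
     would force [dist w v = dist w v + 1]. *)
  apply/setP=> v; rewrite !inE; apply: contraT; rewrite negb_or => /andP[vX vY].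
  have [|w] := mixed v v h0 vY vX; last by lia.
  by apply: hS; rewrite ?SE.
have XY w : w \in X \/ w \in Y by apply/orP; rewrite -in_setU hXY inE.
have mixedS u v k : u \notin Y -> v \notin X ->
    exists2 w, w \in S & dist w (inl u) = dist w (inr (v, k)).
  move=> uY vX; have [||w e] := hF u v.
  - by rewrite inE uY; case: (XY u) => //; rewrite (negPf uY).
  - by rewrite inE vX; case: (XY v) => //; rewrite (negPf vX).
  case: (XY w) => wS.
    have wv : w != v by apply: contraNneq vX => <-.
    exists (inr (w, h0)); first by rewrite SE.
    by rewrite corona_dist_copy_base // corona_dist_copy //; lia.
  exists (inl w); first by rewrite SE.
  by rewrite corona_dist_base // corona_dist_base_copy //; lia.
move=> [u|[u h]] [v|[v k]]; rewrite !SE => uS vS neq.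
- have [w e] := vertex_cover_bisector hY uS vS.
  case: (XY w) => wS; [exists (inr (w, h0))|exists (inl w)]; rewrite ?SE //.
    by rewrite !corona_dist_copy_base // e.
  by rewrite !corona_dist_base.
- exact: mixedS.
- by have [w wS e] := mixedS v u h vS uS; exists w.
- have [w e] := vertex_cover_bisector hX uS vS.
  have [wX|wX] := boolP (w \in X); last first.
    exists (inl w); last by rewrite !corona_dist_base_copy // e.
    by rewrite SE; case: (XY w) => //; rewrite (negPf wX).
  (* As [u] and [v] are outside [X], a copy attached at [w] in [X] is a third copy. *)
  have wu : w != u by apply: contraNneq uS => <-.
  have wv : w != v by apply: contraNneq vS => <-.
  exists (inr (w, h0)); first by rewrite SE.
  by rewrite !corona_dist_copy // e.
Qed.
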